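(* Let $\mathcal{G}=(A,(\preceq_i)_{i\in\mathcal{P}})$ be a game whose preference relations $\preceq_i$ are all $\omega$-recognizable preorders. Then from every initial vertex there exists a Nash equilibrium composed of finite-memory strategies.
   Context: An arena is $A=(V,E,\mathcal{P},(V_i)_i)$ with finite vertex set $V$, edges $E$ (every vertex has a successor), finite player set $\mathcal{P}$ and partition $(V_i)_i$. A relation on $V^\omega$ is $\omega$-recognizable if it equals $\bigcup_{k=1}^{\ell}X_k\times Y_k$ with $X_k,Y_k\subseteq V^\omega$ $\omega$-regular; a preorder is reflexive and transitive. From $\preceq_i$ define the strict part $x\prec_i y$ iff $x\preceq_i y$ and $y\not\preceq_i x$. A strategy of player $i$ maps histories ending in $V_i$ to successors; it is finite-memory if defined by a finite Mealy machine. A Nash equilibrium from $v_0$ is a profile $\sigma$ such that for every player $i$ and every strategy $\tau_i$ of player $i$, $\langle\sigma\rangle_{v_0}\not\prec_i\langle\tau_i,\sigma_{-i}\rangle_{v_0}$, where $\langle\cdot\rangle_{v_0}$ denotes the outcome from $v_0$. *)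

(* Defs.v *)
From mathcomp Require Import all_boot.
From Stdlib Require List.
Set Implicit Arguments. Unset Strict Implicit. Unset Printing Implicit Defensive.

Definition word (V : Type) := nat -> V.

Record buchi (V : Type) := Buchi {
  bstate : finType;
  binit  : pred bstate;
  btrans : bstate -> V -> bstate -> bool;
  bacc   : pred bstate }.

Definition buchi_accepts V (B : buchi V) (w : word V) : Prop :=
  exists r : nat -> bstate B,
    [/\ binit (r 0),
        forall n, btrans (r n) (w n) (r n.+1)
      & forall n, exists2 m, n <= m & bacc (r m)].

Definition omega_regular V (X : word V -> Prop) : Prop :=
  exists B : buchi V, forall w, X w <-> buchi_accepts B w.

Definition omega_recognizable V (R : word V -> word V -> Prop) : Prop :=
  exists s : seq (buchi V * buchi V),
    forall x y, R x y <-> exists2 p, List.In p s & buchi_accepts p.1 x /\ buchi_accepts p.2 y.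

Definition preorder_rel T (R : T -> T -> Prop) : Prop :=
  (forall x, R x x) /\ (forall x y z, R x y -> R y z -> R x z).

Definition strict T (R : T -> T -> Prop) (x y : T) : Prop := R x y /\ ~ R y x.

(* A strategy maps a history, given as (h, v) meaning the history  h ++ [v]
   (so v is its last vertex), to a successor vertex. *)
Definition strategy (V : Type) := seq V -> V -> V.

Definition is_strategy (V P : Type) (E : V -> V -> bool) (owner : V -> P)
  (i : P) (sigma : strategy V) : Prop :=
  forall h v, owner v = i -> E v (sigma h v).

Definition finite_memory (V P : Type) (owner : V -> P) (i : P)
  (sigma : strategy V) : Prop :=
  exists (M : finType) (m0 : M) (upd : M -> V -> M) (nxt : M -> V -> V),
    forall h v, owner v = i -> sigma h v = nxt (foldl upd m0 h) v.

Fixpoint play_prefix (V P : Type) (owner : V -> P) (sigma : P -> strategy V)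
  (v0 : V) (n : nat) : seq V * V :=
  match n with
  | 0 => ([::], v0)
  | n'.+1 => let: (h, v) := play_prefix owner sigma v0 n' in
             (rcons h v, sigma (owner v) h v)
  end.

Definition outcome (V P : Type) (owner : V -> P) (sigma : P -> strategy V)
  (v0 : V) : word V := fun n => (play_prefix owner sigma v0 n).2.

Definition deviate (P : eqType) (V : Type) (sigma : P -> strategy V) (i : P)
  (tau : strategy V) : P -> strategy V :=
  fun j => if j == i then tau else sigma j.

Definition nash_eq (V : Type) (P : eqType) (E : V -> V -> bool) (owner : V -> P)
  (pref : P -> word V -> word V -> Prop) (v0 : V) (sigma : P -> strategy V) : Prop :=
  (forall i, is_strategy E owner i (sigma i)) /\
  forall i (tau : strategy V), is_strategy E owner i tau ->
    ~ strict (pref i) (outcome owner sigma v0) (outcome owner (deviate sigma i tau) v0).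

(* Main.v *)
Require Import Defs.
From mathcomp Require Import all_boot.
From mathcomp Require Import boolp zify.

(** The automata of all players are absorbed into one finite semigroup: the
pair (s, t) of a factorization of a word into a block of image s followed by
blocks of image t decides every preference.  Counting the pairs (s, t) that
have a representative below w turns each preorder into a bounded payoff that
strictly increases along its strict part and whose upper level sets are
omega-regular.

Determinization keeps a list of at most |S| factors of the prefix read so
far.  When a letter makes the list too long, two suffixes have the same image
and a boundary between factors is removed.  If k is the least index at which
removals recur forever, the boundaries before k are eventually fixed, the
boundary at k escapes to infinity, and every pair (s, t) recurring at these
removals comes from a factorization of the whole word; so k ranks the
priorities of a deterministic parity automaton.

In the product of the arena with this automaton, each player has a positional
strategy, and the coalition of the others a positional counter-strategy, that
are optimal for all payoff thresholds simultaneously.  In the equilibrium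
everybody plays optimally until some player deviates, and the others then
punish that player. *)

Set Implicit Arguments. Unset Strict Implicit. Unset Printing Implicit Defensive.

(** * Recurrence in sequences and segments of words *)

Definition infinitely_often (A : nat -> Prop) := forall N, exists2 n, N <= n & A n.
Definition eventually (A : nat -> Prop) := exists N, forall n, N <= n -> A n.

Lemma infinitely_oftenPn A :
  ~ infinitely_often A -> eventually (fun n => ~ A n).
Proof.
move=> /existsNP[N hN]; exists N => n Nn An; apply: hN.
by exists n.
Qed.

Lemma infinitely_often_eventually A B : infinitely_often A -> eventually B ->
  infinitely_often (fun n => A n /\ B n).
Proof.
move=> hA [M hM] N; have [n hn An] := hA (maxn N M).
by exists n; [lia|split=> //; apply: hM; lia].
Qed.

Lemma infinitely_often_sub (A B : nat -> Prop) : (forall n, A n -> B n) ->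
  infinitely_often A -> infinitely_often B.
Proof. by move=> AB hA N; have [n Nn /AB] := hA N; exists n. Qed.

Lemma eventually_and A B : eventually A -> eventually B ->
  eventually (fun n => A n /\ B n).
Proof.
move=> [N hN] [M hM]; exists (maxn N M) => n hn.
by split; [apply: hN|apply: hM]; lia.
Qed.

Lemma eventually_all (T : finType) (A : T -> nat -> Prop) :
  (forall t, eventually (A t)) -> eventually (fun n => forall t, A t n).
Proof.
move=> /choice[N hN]; exists (\max_t N t) => n hn t; apply: hN.
by apply: leq_trans hn; apply: leq_bigmax.
Qed.

Lemma infinitely_often_pigeonhole (T : finType) (F : nat -> T) A :
  infinitely_often A -> exists t, infinitely_often (fun n => A n /\ F n = t).
Proof.
move=> hA; apply: contrapT => /forallNP h.
have /eventually_all hev t := infinitely_oftenPn (h t).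
by have [n _ [An /(_ (F n))]] := infinitely_often_eventually hA hev 0; apply.
Qed.

(** The pigeonhole principle gives a recurring value; each value below the least recurring one
    occurs only finitely often. *)
Lemma bounded_liminf (F : nat -> nat) b : eventually (fun n => F n <= b) ->
  exists k, infinitely_often (fun n => F n = k) /\ eventually (fun n => k <= F n).
Proof.
move=> hb; have [|t ht] := @infinitely_often_pigeonhole _
    (fun n => inord (F n) : 'I_b.+1) (fun n => F n <= b).
  by case: hb => M hM N; exists (maxn N M); [lia|apply: hM; lia].
have ex : exists k, `[< infinitely_often (fun n => F n = k) >].
  exists t; apply/asboolP; apply: infinitely_often_sub ht => n [Fb <-].
  by rewrite inordK.
case: (ex_minnP ex) => k /asboolP hk kmin; exists k; split=> //.
have : eventually (fun n => forall t : 'I_k, F n <> t).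
  apply: eventually_all => c; apply: infinitely_oftenPn => hc.
  by have := kmin c; rewrite leqNgt ltn_ord => /(_ (introT (asboolP _) hc)).
case=> N hN; exists N => n /hN h; rewrite leqNgt; apply/negP => lt.
exact: (h (Ordinal lt)).
Qed.

Definition segment V (w : word V) m n : seq V := map w (iota m (n - m)).

Lemma segment_cat V (w : word V) m n p : m <= n -> n <= p ->
  segment w m n ++ segment w n p = segment w m p.
Proof.
move=> mn np; rewrite /segment -map_cat; congr map.
by rewrite -[in LHS](subnKC mn) addKn -iotaD; congr iota; lia.
Qed.

Lemma segmentS V (w : word V) m n : m <= n ->
  segment w m n.+1 = rcons (segment w m n) (w n).
Proof.
move=> mn; rewrite -(@segment_cat _ _ m n n.+1) // -cats1; congr cat.
by rewrite /segment subSnn.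
Qed.

Lemma size_segment V (w : word V) m n : size (segment w m n) = n - m.
Proof. by rewrite size_map size_iota. Qed.

(** * Finite recognizers *)

Definition multiplicative V S (phi : seq V -> S) (mul : S -> S -> S) :=
  forall u v, phi (u ++ v) = mul (phi u) (phi v).

Definition factors V S (phi : seq V -> S) (w : word V) (c : S * S) :=
  exists f : nat -> nat, [/\ f 0 = 0, forall n, f n < f n.+1,
    phi (segment w (f 0) (f 1)) = c.1
    & forall n, phi (segment w (f n.+1) (f n.+2)) = c.2].

Definition saturates V S (phi : seq V -> S) (X : word V -> Prop) :=
  forall c w w', factors phi w c -> factors phi w' c -> X w -> X w'.

(** * Transition profiles of Buchi automata *)

Section BuchiProfile.
Variables (V : Type) (B : buchi V).
Local Notation Q := (bstate B).

(* With [b = true], the run must also visit an accepting state after its first state. *)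
Fixpoint reach (u : seq V) (b : bool) (q q' : Q) : bool :=
  if u is a :: u' then
    [exists q1, btrans q a q1 &&
      (reach u' b q1 q' || [&& b, bacc q1 & reach u' false q1 q'])]
  else ~~ b && (q == q').

Definition profile (u : seq V) : {ffun Q * Q * bool -> bool} :=
  [ffun x => reach u x.2 x.1.1 x.1.2].

Definition profile_mul (s t : {ffun Q * Q * bool -> bool}) :
    {ffun Q * Q * bool -> bool} :=
  [ffun x => let: (q, q', b) := x in
   [exists q1, [&& s (q, q1, b) & t (q1, q', false)]
            || [&& s (q, q1, false) & t (q1, q', b)]]].

Lemma reach_cat u v b q q' :
  reach (u ++ v) b q q' =
  [exists q1, (reach u b q q1 && reach v false q1 q')
           || (reach u false q q1 && reach v b q1 q')].
Proof.
elim: u b q => [|a u IH] b q /=.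
  apply/idP/existsP => [h|[q1]].
    by exists q; rewrite eqxx h orbT.
  by case/orP => /andP[]; [case: b => //= /eqP-> |move=> /eqP->].
apply/existsP/existsP => [[q1 /andP[tr]]|[q1]].
  rewrite !IH => /orP[/existsP[q2 h]|/and3P[hb ac /existsP[q2 h]]].
    exists q2; case/orP: h => /andP[h1 h2]; apply/orP; [left|right].
      by rewrite h2 andbT; apply/existsP; exists q1; rewrite tr h1.
    by rewrite h2 andbT; apply/existsP; exists q1; rewrite tr h1.
  exists q2; apply/orP; left; case/orP: h => /andP[h1 h2];
  by rewrite h2 andbT; apply/existsP; exists q1; rewrite tr hb ac h1 orbT.
case/orP => /andP[/existsP[q2 /andP[tr h]] h2]; exists q2; rewrite tr !IH /=.
  apply/orP; case/orP: h => [h|/and3P[hb ac h]].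
    by left; apply/existsP; exists q1; rewrite h h2.
  by right; rewrite hb ac; apply/existsP; exists q1; rewrite h h2.
case/orP: h => // h; apply/orP; left; apply/existsP; exists q1.
by rewrite h h2 orbT.
Qed.

Lemma profileM : multiplicative profile profile_mul.
Proof.
by move=> u v; apply/ffunP => -[[q q'] b]; rewrite !ffunE /= reach_cat;
  apply: eq_existsb => q1; rewrite !ffunE.
Qed.

Lemma reach_segmentP (w : word V) m l b q q' :
  reach (map w (iota m l)) b q q' <->
  exists p : nat -> Q, [/\ p 0 = q, p l = q',
    forall i, i < l -> btrans (p i) (w (m + i)) (p i.+1)
    & b -> exists2 i, i < l & bacc (p i.+1)].
Proof.
elim: l m b q => [|l IH] m b q /=.
  split=> [/andP[nb /eqP <-]|[p [<- <- _ h]]].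
    by exists (fun=> q); split=> // hb; rewrite hb in nb.
  by rewrite eqxx andbT; apply/negP => /h[].
split=> [/existsP[q1 /andP[tr h]]|[p [p0 pl tr h]]].
  have [p [p0 pl tr' ac]] : exists p : nat -> Q, [/\ p 0 = q1, p l = q',
    forall i, i < l -> btrans (p i) (w (m.+1 + i)) (p i.+1)
    & b -> bacc q1 \/ exists2 i, i < l & bacc (p i.+1)].
    case/orP: h => [/IH[p [? ? ? h]]|/and3P[_ ac /IH[p [? ? ? _]]]].
      by exists p; split=> // /h; right.
    by exists p; split=> // _; left.
  exists (fun n => if n is n'.+1 then p n' else q); split=> //.
    by case=> [_|i il]; rewrite ?addn0 ?p0 // addnS -addSn; apply: tr'.
  case/ac => [q1a|[i il ai]]; first by exists 0; rewrite ?p0.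
  by exists i.+1.
apply/existsP; exists (p 1); rewrite -p0.
have := tr 0 isT; rewrite addn0 => ->/=.
have tr' i : i < l -> btrans (p i.+1) (w (m.+1 + i)) (p i.+2).
  by move=> il; rewrite addSnnS; apply: tr.
apply/orP; case: b h => h; last first.
  by left; apply/IH; exists (fun n => p n.+1); split.
have [[|i] il ai] := h isT.
  by right; rewrite ai; apply/IH; exists (fun n => p n.+1); split.
by left; apply/IH; exists (fun n => p n.+1); split=> //; exists i.
Qed.

End BuchiProfile.

(** The index of the block of [f] containing [m]: as the cuts strictly increase, each step to the
    next position crosses at most one of them. *)
Fixpoint block (f : nat -> nat) m :=
  if m is m'.+1 then
    if f (block f m').+1 == m then (block f m').+1 else block f m'
  else 0.

Lemma blockP f m : f 0 = 0 -> (forall n, f n < f n.+1) ->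
  f (block f m) <= m < f (block f m).+1.
Proof.
move=> f0 fS; elim: m => [|m IH] /=; first by rewrite f0 leqnn -{1}f0 fS.
case: eqP => [e|/eqP ne]; first by rewrite e leqnn -{1}e fS.
by move/andP: IH => [h1 h2]; rewrite ltn_neqAle eq_sym ne h2 (leq_trans h1).
Qed.

Lemma cuts_ge f n : (forall n, f n < f n.+1) -> n <= f n.
Proof. by move=> fS; elim: n => // n IH; apply: leq_ltn_trans IH (fS n). Qed.

Lemma cuts_le f : (forall n, f n < f n.+1) -> {homo f : m n / m <= n}.
Proof. by move=> fS; apply: homo_leq => [//|? ? ?|n]; [apply: leq_trans|apply: ltnW]. Qed.

Lemma block_unique f m n : f 0 = 0 -> (forall n, f n < f n.+1) ->
  f n <= m < f n.+1 -> block f m = n.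
Proof.
move=> f0 fS /andP[h1 h2]; have /andP[h3 h4] := blockP m f0 fS.
apply/eqP; rewrite eqn_leq; apply/andP; split; rewrite leqNgt; apply/negP.
  move=> /(cuts_le fS); lia.
move=> /(cuts_le fS); lia.
Qed.

(** An accepting run on [w] is cut at the positions [f n]. Blocks with equal profiles connect the
    same states with the same acceptance information, so each piece is replaced by a run on the
    matching block of [w'] and the pieces are glued. *)
Lemma buchi_saturated V (B : buchi V) :
  saturates (@profile V B) (buchi_accepts B).
Proof.
move=> c w w' [f [f0 fS fa ft]] [g [g0 gS ga gt]] [r [ri rt ra]].
(* The interval is open on the left, as in [reach], so that each accepting visit at a positive
   position belongs to exactly one block. *)
pose b n := `[< exists2 m, f n < m <= f n.+1 & bacc (r m) >].
have hreach n : reach (segment w (f n) (f n.+1)) (b n) (r (f n)) (r (f n.+1)).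
  apply/reach_segmentP; exists (fun i => r (f n + i)); split.
  - by rewrite addn0.
  - by rewrite subnKC // ltnW.
  - by move=> i _; rewrite addnS; apply: rt.
  case/asboolP=> m hm am; exists (m - (f n).+1); first lia.
  by rewrite addnS -addSn subnKC //; case/andP: hm.
have hreach' n : reach (segment w' (g n) (g n.+1)) (b n) (r (f n)) (r (f n.+1)).
  have : profile B (segment w (f n) (f n.+1)) = profile B (segment w' (g n) (g n.+1)).
    by case: n => [|n]; rewrite ?fa ?ga ?ft ?gt.
  move=> /ffunP/(_ (r (f n), r (f n.+1), b n)); rewrite !ffunE /= => <-.
  exact: hreach.
have /choice[p hp] : forall n, exists p : nat -> bstate B,
    [/\ p 0 = r (f n), p (g n.+1 - g n) = r (f n.+1),
      forall i, i < g n.+1 - g n -> btrans (p i) (w' (g n + i)) (p i.+1)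
      & b n -> exists2 i, i < g n.+1 - g n & bacc (p i.+1)].
  by move=> n; apply/reach_segmentP/hreach'.
pose r' m := p (block g m) (m - g (block g m)).
(* The right endpoint is included: there [r'] reads the next piece, whose first state is the last
   state of this one. *)
have r'E n i : i <= g n.+1 - g n -> r' (g n + i) = p n i.
  rewrite leq_eqVlt => /orP[/eqP->|lt]; last first.
    rewrite /r' (@block_unique _ _ n) //; first by rewrite addKn.
    lia.
  have h := gS n; rewrite subnKC; last exact: ltnW.
  rewrite /r' (@block_unique _ _ n.+1) // ?leqnn ?gS // subnn.
  by have [-> _ _ _] := hp n.+1; have [_ -> _ _] := hp n.
exists r'; split.
- by rewrite /r' /= g0 subnn; have [-> _ _ _] := hp 0; rewrite f0.
- move=> m; have /andP[h1 h2] := blockP m g0 gS.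
  set n := block g m in h1 h2; rewrite -(subnKC h1) -addnS.
  have lt : m - g n < g n.+1 - g n by lia.
  rewrite !r'E //; last exact: ltnW.
  by have [_ _ + _] := hp n; apply.
(* An accepting visit after [f N] lies in a block of index at least [N], and the matching block of
   [w'] starts at position [N] or later. *)
move=> N; have [m hm am] := ra (f N).+1.
case: m => // m in hm am; have /andP[h1 h2] := blockP m f0 fS.
set n := block f m in h1 h2.
have [_ _ _ []] := hp n; first by apply/asboolP; exists m.+1 => //; lia.
move=> i il ai; exists (g n + i.+1); last by rewrite r'E.
have : N < n.+1.
  rewrite ltnNge; apply/negP => /(cuts_le fS); lia.
by have := cuts_ge n gS; lia.
Qed.

Lemma factors_comp V S S' (phi : seq V -> S) (h : S -> S') w c :
  factors phi w c -> factors (h \o phi) w (h c.1, h c.2).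
Proof. by case=> f [f0 fS f1 f2]; exists f; split=> //= [|n]; rewrite ?f1 ?f2. Qed.

Lemma saturates_comp V S S' (phi : seq V -> S) (h : S -> S') X :
  saturates (h \o phi) X -> saturates phi X.
Proof.
by move=> hX c w w' /(factors_comp h) fw /(factors_comp h) fw'; apply: hX fw fw'.
Qed.

(** Products of recognizers suffice, because a finer recognizer still saturates. *)
Lemma common_recognizer V (l : seq (buchi V)) :
  exists (S : finType) (phi : seq V -> S) mul, multiplicative phi mul /\
    forall B, List.In B l -> saturates phi (buchi_accepts B).
Proof.
elim: l => [|B l [S [phi [mul [phiM hl]]]]].
  by exists unit, (fun=> tt), (fun _ _ => tt); split.
exists ({ffun bstate B * bstate B * bool -> bool} * S)%type,
  (fun u => (profile B u, phi u)),
  (fun s t => (profile_mul s.1 t.1, mul s.2 t.2)); split.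
  by move=> u v /=; rewrite profileM phiM.
move=> B' /= [<-|hB'].
  exact: (@saturates_comp _ _ _ (fun u => (profile B u, phi u)) fst)
    (@buchi_saturated _ B).
exact: (@saturates_comp _ _ _ (fun u => (profile B u, phi u)) snd) (hl _ hB').
Qed.

(** * Determinization *)

Lemma cat_eq_segment V (w : word V) u v m n : u ++ v = segment w m n ->
  u = segment w m (m + size u) /\ v = segment w (m + size u) n.
Proof.
move=> e; have := congr1 size e; rewrite size_cat size_segment => sz.
have : segment w m (m + size u) ++ segment w (m + size u) n = u ++ v.
  case: (leqP m n) => mn; first by rewrite segment_cat //; lia.
  have [-> ->] : u = [::] /\ v = [::].
    by split; apply: size0nil; lia.
  by rewrite /segment /= addn0 subnn (_ : n - m = 0) //; lia.
move=> E; have su : size (segment w m (m + size u)) = size u.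
  by rewrite size_segment addKn.
split.
  by rewrite -[LHS](@take_size_cat _ (size u) u v) // -E take_size_cat.
by rewrite -[LHS](@drop_size_cat _ (size u) u v) // -E drop_size_cat.
Qed.

Fixpoint fuse T (op : T -> T -> T) i (l : seq T) : seq T :=
  match i, l with
  | 0, x :: y :: l' => op x y :: l'
  | i'.+1, x :: l' => x :: fuse op i' l'
  | _, _ => l
  end.

Lemma size_fuse T (op : T -> T -> T) i l : i.+1 < size l ->
  size (fuse op i l) = (size l).-1.
Proof.
elim: i l => [|i IH] [|x [|y l]] //= h.
by rewrite IH.
Qed.

Lemma map_fuse T T' (h : T -> T') op op' i l :
  (forall x y, h (op x y) = op' (h x) (h y)) ->
  map h (fuse op i l) = fuse op' i (map h l).
Proof.
move=> hop; elim: i l => [|i IH] [|x l] //=; last by rewrite IH.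
by case: l => [|y l] //=; rewrite hop.
Qed.

Lemma take_fuse T (op : T -> T -> T) i j l : j <= i ->
  take j (fuse op i l) = take j l.
Proof. by elim: i j l => [|i IH] [|j] [|x l] //= h; rewrite ?take0 // IH. Qed.

Lemma flatten_take_fuse T i (g : seq (seq T)) : i.+1 < size g ->
  flatten (take i.+1 (fuse cat i g)) = flatten (take i.+2 g).
Proof.
elim: i g => [|i IH] [|x g] //=.
  by case: g => [|y g] //= _; rewrite !take0 /= catA.
by move=> h; rewrite /= IH.
Qed.

Lemma flatten_fuse T i (g : seq (seq T)) : flatten (fuse cat i g) = flatten g.
Proof.
elim: i g => [|i IH] [|x g] //=; last by rewrite IH.
by case: g => [|y g] //=; rewrite catA.
Qed.

Lemma all_fuse_nonempty T i (g : seq (seq T)) :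
  all (fun u => 0 < size u) g -> all (fun u => 0 < size u) (fuse cat i g).
Proof.
elim: i g => [|i IH] [|x g] //=; last by move=> /andP[-> /IH].
by case: g => [|y g] //= /and3P[hx hy ->]; rewrite size_cat; lia.
Qed.

Section Determinization.
Variables (V : Type) (S : finType) (phi : seq V -> S) (mul : S -> S -> S).
Hypothesis phiM : multiplicative phi mul.
Variable N : nat.
Hypothesis cardS : #|S| <= N.

Definition product (c : seq S) := foldr mul (phi [::]) c.

Lemma product_map_phi g : product (map phi g) = phi (flatten g).
Proof. by elim: g => //= u g ->; rewrite phiM. Qed.

(* A pair of boundaries [j < i.+1] whose suffixes have the same image: the
   boundary [i.+1] is redundant and can be removed. *)
Definition collision (c : seq S) : option ('I_N * 'I_N) :=
  [pick x : 'I_N * 'I_N |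
    (x.1 <= x.2) && (product (drop x.1 c) == product (drop x.2.+1 c))].

(* Applied to images of factors ([h = id]) and to the factors themselves ([h = phi]). *)
Definition reduce T (op : T -> T -> T) (h : T -> S) (g : seq T) : seq T :=
  if size g <= N then g
  else if collision (map h g) is Some x then fuse op x.2 g else g.

Definition det_step (d : N.-bseq S) (a : V) : N.-bseq S :=
  insub_bseq N (reduce mul id (rcons d (phi [:: a]))).

(* One less than the index of the boundary removed when reading [a] in state [d]. *)
Definition level (d : N.-bseq S) (a : V) : nat :=
  if collision (rcons d (phi [:: a])) is Some x then x.2 else 0.

(* The images of the prefix before the removed boundary and of the block
   between the two colliding boundaries. *)
Definition label (d : N.-bseq S) (a : V) : S * S :=
  let c := rcons d (phi [:: a]) in
  if collision c is Some x then
    (product (take x.2.+1 c), product (take (x.2.+1 - x.1) (drop x.1 c)))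
  else (phi [::], phi [::]).

(** There are [N.+1] suffixes, at indices 0 to [N], but at most [N] images. The larger index [j] of
    a coinciding pair is positive and is stored as [j.-1]. *)
Lemma collision_exists c : exists x, [/\ collision c = Some x,
  x.1 <= x.2 & product (drop x.1 c) = product (drop x.2.+1 c)].
Proof.
rewrite /collision; case: pickP => [x /andP[h1 /eqP h2]|none].
  by exists x.
have : ~~ injectiveb (fun i : 'I_N.+1 => product (drop i c)).
  apply/negP => /injectiveP /card_codom; rewrite card_ord => e.
  have := max_card (mem (codom (fun i : 'I_N.+1 => product (drop i c)))).
  by rewrite e ltnNge cardS.
case/injectivePn => i [j ne e].
wlog hlt : i j ne e / i < j.
  move=> H; case: (ltngtP i j) => [/H|/H|/val_inj h]; first exact.
    by apply; rewrite // eq_sym.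
  by rewrite h eqxx in ne.
have [hi hj] : i < N /\ j.-1 < N by have := ltn_ord j; lia.
have /= := none (Ordinal hi, Ordinal hj).
have j0 : 0 < (j : nat) by exact: leq_ltn_trans hlt.
by rewrite prednK // e eqxx andbT -ltnS prednK // hlt.
Qed.

Section Run.
Variable w : word V.

Fixpoint det_run n : N.-bseq S :=
  if n is n'.+1 then det_step (det_run n') (w n') else insub_bseq N [::].

(* The factors of the prefix of length [n] whose images form the state. *)
Fixpoint ghost n : seq (seq V) :=
  if n is n'.+1 then reduce cat phi (rcons (ghost n') [:: w n']) else [::].

Let ext n := rcons (ghost n) [:: w n].
Let boundary g i := size (flatten (take i g) : seq V).

Lemma N_gt0 : 0 < N.
Proof. by apply: leq_trans cardS; apply/card_gt0P; exists (phi [::]). Qed.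

Lemma size_ghost n : size (ghost n) = minn n N.
Proof.
have := N_gt0; elim: n => [|n IH] hN /=; first by rewrite min0n.
have se : size (ext n) = (minn n N).+1 by rewrite size_rcons IH.
rewrite -/(ext n) /reduce se; have [hle|hgt] := boolP ((minn n N).+1 <= N).
  by rewrite se; lia.
have [[j i] [-> hij _]] := collision_exists (map phi (ext n)).
by rewrite size_fuse se /=; have := ltn_ord i; lia.
Qed.

Lemma det_runE n : det_run n = map phi (ghost n) :> seq S.
Proof.
elim: n => [|n IH] /=.
  by rewrite /insub_bseq /insubd insubT.
rewrite /det_step IH -map_rcons.
have -> : reduce mul id (map phi (rcons (ghost n) [:: w n])) =
    map phi (reduce cat phi (rcons (ghost n) [:: w n])).
  rewrite /reduce size_map map_id; case: ifP => // _.
  by case: (collision _) => // x; rewrite (map_fuse _ _ phiM).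
(* The default of [insub_bseq] does not occur, since [reduce] leaves at most [N] factors. *)
rewrite /insub_bseq val_insubd size_map.
by rewrite -[reduce _ _ _]/(ghost n.+1) size_ghost geq_minr.
Qed.

Lemma flatten_ghost n : flatten (ghost n) = segment w 0 n.
Proof.
elim: n => //= n IH; rewrite segmentS // -IH.
have -> : rcons (flatten (ghost n)) (w n) = flatten (rcons (ghost n) [:: w n]).
  by rewrite flatten_rcons cats1.
rewrite /reduce.
case: ifP => // _; case: (collision _) => // x; exact: flatten_fuse.
Qed.

Lemma ghost_nonempty n : all (fun u => 0 < size u) (ghost n).
Proof.
elim: n => //= n IH; have h : all (fun u => 0 < size u) (ext n).
  by rewrite all_rcons.
rewrite /reduce; case: ifP => // _; case: (collision _) => // x.
exact: all_fuse_nonempty.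
Qed.

Lemma flatten_ext n : flatten (ext n) = segment w 0 n.+1.
Proof. by rewrite /ext -cats1 flatten_cat /= flatten_ghost segmentS // cats1. Qed.

Lemma ext_take n i : flatten (take i (ext n)) = segment w 0 (boundary (ext n) i).
Proof.
have := flatten_ext n; rewrite -{1}(cat_take_drop i (ext n)) flatten_cat.
by case/cat_eq_segment.
Qed.

Lemma ext_drop n i :
  flatten (drop i (ext n)) = segment w (boundary (ext n) i) n.+1.
Proof.
have := flatten_ext n; rewrite -{1}(cat_take_drop i (ext n)) flatten_cat.
by case/cat_eq_segment.
Qed.

Lemma boundary_le n i j : i <= j -> boundary (ext n) i <= boundary (ext n) j.
Proof.
move=> ij; rewrite /boundary -(subnKC ij) takeD flatten_cat size_cat.
exact: leq_addr.
Qed.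

Lemma ext_mid n i j : i <= j -> flatten (take (j - i) (drop i (ext n))) =
  segment w (boundary (ext n) i) (boundary (ext n) j).
Proof.
move=> ij; have := ext_take n j; rewrite -{1}(subnKC ij) takeD flatten_cat.
by case/cat_eq_segment.
Qed.

Lemma boundary_le_ext n i : boundary (ext n) i <= n.+1.
Proof.
have := congr1 size (flatten_ext n); rewrite size_segment subn0 => <-.
rewrite -(cat_take_drop i (ext n)) flatten_cat size_cat /boundary.
by rewrite cat_take_drop leq_addr.
Qed.

Lemma boundary_ltS n i : i < size (ext n) ->
  boundary (ext n) i < boundary (ext n) i.+1.
Proof.
move=> h; rewrite /boundary (take_nth [::] h) flatten_rcons size_cat.
have : all (fun u => 0 < size u) (ext n) by rewrite all_rcons ghost_nonempty.
by move=> /all_nthP/(_ _ h) => ?; rewrite -addn1 leq_add2l.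
Qed.

Lemma boundary_ext n i : i <= size (ghost n) ->
  boundary (ext n) i = boundary (ghost n) i.
Proof. by move=> h; rewrite /boundary /ext -cats1 takel_cat. Qed.

(** From time [N] on every letter makes the list too long, so a boundary is really removed; the
    collision is translated here from images into segments of [w]. *)
Lemma run_collision n : N <= n -> exists x : 'I_N * 'I_N,
  [/\ collision (rcons (det_run n) (phi [:: w n])) = Some x,
      ghost n.+1 = fuse cat x.2 (ext n),
      level (det_run n) (w n) = x.2,
      label (det_run n) (w n) = (phi (segment w 0 (boundary (ext n) x.2.+1)),
        phi (segment w (boundary (ext n) x.1) (boundary (ext n) x.2.+1)))
    & x.1 <= x.2 /\ phi (segment w (boundary (ext n) x.1) n.+1) =
       phi (segment w (boundary (ext n) x.2.+1) n.+1)].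
Proof.
move=> hn; have sz : size (ext n) = N.+1 by rewrite size_rcons size_ghost; lia.
rewrite /level /label det_runE -map_rcons -/(ext n).
have [x [ex h1 h2]] := collision_exists (map phi (ext n)).
exists x; rewrite ex; split=> //.
- by rewrite /= -/(ext n) /reduce sz ltnn ex.
- rewrite -!map_take -map_drop -map_take !product_map_phi ext_take ext_mid //.
  exact: leqW.
- by move: h2; rewrite -!map_drop !product_map_phi !ext_drop.
Qed.

(** [k] is the limit inferior of the levels. Since a level is one less than an index, the boundaries
    up to [k] freeze and boundary [k.+1] escapes to infinity; positions of the latter are the cuts
    of the factorization. *)
Lemma det_run_factors : exists k,
  [/\ infinitely_often (fun n => level (det_run n) (w n) = k),
      eventually (fun n => k <= level (det_run n) (w n))
    & forall c, infinitely_often (fun n => level (det_run n) (w n) = k /\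
                                   label (det_run n) (w n) = c) ->
        factors phi w c].
Proof.
have [|k [ho hev]] := @bounded_liminf (fun n => level (det_run n) (w n)) N.
  exists N => n /run_collision[x [_ _ -> _ _]]; exact: ltnW.
exists k; split=> // c hc.
have [N0 hN0] : eventually (fun n => N <= n /\ k <= level (det_run n) (w n)).
  by apply: eventually_and => //; exists N.
have kN : k < N.
  have [n hn e] := ho N0; have [hNn _] := hN0 _ hn.
  by have [x [_ _ ex _ _]] := run_collision hNn; rewrite -e ex.
have szg n : N0 <= n -> size (ghost n) = N.
  by move=> /hN0[? _]; rewrite size_ghost; lia.
have stable n j : j <= k -> N0 <= n ->
    boundary (ext n) j = boundary (ghost N0) j.
  move=> jk hn; rewrite boundary_ext; last by rewrite szg //; lia.
  elim: n hn => [|n IH]; first by rewrite leqn0 => /eqP->.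
  rewrite leq_eqVlt => /orP[/eqP->//|hn].
  have [hNn hk] := hN0 _ hn; have [x [_ -> ex _ _]] := run_collision hNn.
  rewrite -IH // {1}/boundary take_fuse; last by rewrite -ex; lia.
  by rewrite -/(boundary (ext n) j) boundary_ext // szg //; lia.
(* A removal at level [k] makes the former boundary [k.+2] the new boundary [k.+1], strictly farther
   since factors are nonempty; removals at higher levels leave it in place. *)
have stepB n : N0 <= n -> boundary (ext n) k.+1 +
    (level (det_run n) (w n) == k) <= boundary (ext n.+1) k.+1.
  move=> hn; have [hNn hk] := hN0 _ hn.
  have [x [_ eg ex _ _]] := run_collision hNn.
  rewrite [boundary (ext n.+1) _]boundary_ext; last by rewrite szg //; lia.
  rewrite eg /boundary ex in hk *; case: eqP => [e|ne].
    rewrite -e flatten_take_fuse; last by rewrite size_rcons szg // ltnS e.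
    by rewrite addn1; apply: boundary_ltS; rewrite size_rcons szg // ltnS e.
  by rewrite addn0 take_fuse //; lia.
have monoB m n : N0 <= m -> m <= n ->
    boundary (ext m) k.+1 <= boundary (ext n) k.+1.
  move=> hm; elim: n => [|n IH]; first by rewrite leqn0 => /eqP->.
  rewrite leq_eqVlt => /orP[/eqP->//|mn].
  apply: leq_trans (IH mn) _; apply: leq_trans (stepB n _); first exact: leq_addr.
  exact: leq_trans hm mn.
have unbounded M : eventually (fun n => M <= boundary (ext n) k.+1).
  elim: M => [|M [N1 hN1]]; first by exists 0.
  have [n hn e] := ho (maxn N0 N1); exists n.+1 => m hm.
  have : boundary (ext n) k.+1 < boundary (ext n.+1) k.+1.
    by have := @stepB n; rewrite e eqxx addn1; apply; lia.
  have := @monoB n.+1 m; have := hN1 n; lia.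
(* The colliding pair is also made constant along recurring times; its first component is at most
   [k], so the left boundary [m] below is frozen. *)
have [xo] := infinitely_often_pigeonhole
  (fun n => collision (rcons (det_run n) (phi [:: w n]))) hc.
move=> /infinitely_often_eventually hA.
pose B n := boundary (ext n) k.+1.
have [m hm] : exists m, infinitely_often (fun n =>
   [/\ phi (segment w 0 (B n)) = c.1, phi (segment w m (B n)) = c.2,
     phi (segment w m n.+1) = phi (segment w (B n) n.+1) & m <= B n <= n.+1]).
  have [n0 hn0 [[_ exo] _]] := hA _ (ex_intro _ N0 (fun n h => h)) N0.
  have [hNn0 _] := hN0 _ hn0.
  have [x [ex _ _ _ [jk _]]] := run_collision hNn0.
  exists (boundary (ghost N0) x.1).
  apply: infinitely_often_sub (hA _ (ex_intro _ N0 (fun n h => h))) => n.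
  move=> [[[elev elab] exn] hn]; have [hNn _] := hN0 _ hn.
  have [x' [ex' _ elev' elab' [_ esuf]]] := run_collision hNn.
  have ? : x' = x by move: ex'; rewrite exn -exo ex => -[].
  subst x'; have ek : x.2 = k :> nat by rewrite -elev.
  have e1 : boundary (ext n) x.1 = boundary (ghost N0) x.1.
    by apply: stable => //; rewrite -ek.
  rewrite elab in elab'; rewrite elab' /= -e1 /B -ek; split=> //.
  by rewrite boundary_le_ext andbT boundary_le // leqW.
have /choice[h hh] : forall M, exists n, M <= B n /\
   [/\ phi (segment w 0 (B n)) = c.1, phi (segment w m (B n)) = c.2,
     phi (segment w m n.+1) = phi (segment w (B n) n.+1) & m <= B n <= n.+1].
  move=> M; have [n _ [h1 h2]] := infinitely_often_eventually hm (unbounded M) 0.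
  by exists n.
(* Each next cut lies beyond [(e l).+1], the length of the prefix on which the collision at time
   [e l] occurs; [h 1] makes the first cut positive. *)
pose e := fix e l := if l is l'.+1 then h (e l').+2 else h 1.
exists (fun l => if l is l'.+1 then B (e l') else 0); split=> //.
- case=> [|l]; first by have [] := hh 1.
  have [h1 _] := hh (e l).+2.
  have : B (e l) <= (e l).+1 by case: l {h1} => [|l]; [have [_ [_ _ _]] := hh 1|
    have [_ [_ _ _]] := hh (e l).+2]; case/andP.
  by move=> h2; apply: leq_ltn_trans h2 _.
- by have [_ []] := hh 1.
move=> l; have hl : [/\ phi (segment w 0 (B (e l))) = c.1,
    phi (segment w m (B (e l))) = c.2,
    phi (segment w m (e l).+1) = phi (segment w (B (e l)) (e l).+1)
    & m <= B (e l) <= (e l).+1].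
  by case: l => [|l]; [have [] := hh 1|have [] := hh (e l).+2].
have [h1 [_ h2 _ h3]] := hh (e l).+2.
case: hl => _ _ hl /andP[mB Be].
(* The block is split at [(e l).+1]. By the collision its first part has the image of the segment
   from [m], so the whole block has the image of the segment from [m] to the next cut, which is
   [c.2]. *)
rewrite -(@segment_cat _ w (B (e l)) (e l).+1) //; last exact: ltnW.
rewrite phiM -hl -phiM segment_cat //; first exact: leq_trans Be.
exact: ltnW.
Qed.

End Run.
End Determinization.

(** * Positional determinacy of parity games *)

(** Min-parity condition: [k] is the least priority that recurs. *)
Definition parity_wins G (pr : G -> nat) (p : bool) (x : nat -> G) :=
  exists k, [/\ odd k = p, infinitely_often (fun n => pr (x n) = k)
             & eventually (fun n => k <= pr (x n))].

Lemma parity_wins_shift G (pr : G -> nat) p m x :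
  parity_wins pr p (fun n => x (m + n)) <-> parity_wins pr p x.
Proof.
split=> -[k [kp ho [N hN]]]; exists k; split=> //.
- by move=> M; have [n hn e] := ho M; exists (m + n) => //; lia.
- by exists (m + N) => n hn; rewrite -(@subnKC m n); [apply: hN|]; lia.
- move=> M; have [n hn e] := ho (m + M); exists (n - m); first lia.
  by rewrite subnKC //; lia.
- by exists N => n hn; apply: hN; lia.
Qed.

Lemma parity_wins_exclusive G (pr : G -> nat) x :
  parity_wins pr true x -> parity_wins pr false x -> False.
Proof.
move=> [k [ko hk hek]] [l [lo hl hel]].
have [n _ [e1 h1]] := infinitely_often_eventually hk hel 0.
have [m _ [e2 h2]] := infinitely_often_eventually hl hek 0.
have : k = l by lia.
by move=> kl; rewrite kl lo in ko.
Qed.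

Section Parity.
Variables (G : finType) (e : rel G) (own : G -> bool) (pr : G -> nat).

Definition subgame (A : {set G}) := forall x, x \in A -> exists2 y, y \in A & e x y.

Definition follows p (s : G -> G) (x : nat -> G) :=
  forall n, own (x n) = p -> x n.+1 = s (x n).

Definition winning (A R : {set G}) p (s : G -> G) :=
  [/\ forall x, x \in R -> own x = p -> e x (s x) /\ s x \in R,
      forall x y, x \in R -> own x <> p -> e x y -> y \in A -> y \in R
    & forall x : nat -> G, (forall n, x n \in R) ->
        (forall n, e (x n) (x n.+1)) -> follows p s x -> parity_wins pr p x].

(** Zielonka's attractor of [T] for [p], grown one vertex at a time: a vertex from which [p] forces
    the next step into [T] joins the target, and the strategy is patched there. When there is none,
    [T] is its own attractor. *)
Lemma attractor_exists (A T : {set G}) p : subgame A -> T \subset A ->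
  exists (X : {set G}) (s : G -> G),
  [/\ T \subset X, X \subset A,
    [/\ forall x, x \in X -> x \notin T -> own x = p -> e x (s x) /\ s x \in X,
      forall x y, x \in X -> x \notin T -> own x <> p -> e x y -> y \in A -> y \in X
    & forall x : nat -> G, (forall n, x n \in A) -> (forall n, e (x n) (x n.+1)) ->
      (forall n, x n \in X -> x n \notin T -> own (x n) = p -> x n.+1 = s (x n)) ->
      x 0 \in X -> exists n, x n \in T],
    forall x y, x \in A -> x \notin X -> own x = p -> e x y -> y \notin X
  & forall x, x \in A -> x \notin X -> own x <> p ->
      exists y, [/\ y \in A, y \notin X & e x y]].
Proof.
move=> subA; have [n] := ubnP #|A :\: T|; elim: n T => // n IH T hn TA.
have [[x [y [xA xT h]]]|none] := EM (exists x y, [/\ x \in A, x \notin T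
    & own x = p /\ e x y /\ y \in T \/
      own x <> p /\ forall z, z \in A -> e x z -> z \in T]); last first.
  exists T, id; split=> //.
  - split; [by move=> x ->|by move=> x y ->|by move=> x _ _ _ x0; exists 0].
  - move=> x y xA xT ow exy; apply/negP => yT; apply: none.
    by exists x, y; split=> //; left.
  move=> x xA xT ow; apply: contrapT => h; apply: none; exists x, x; split=> //.
  right; split=> // z zA exz; apply: contrapT => zT; apply: h; exists z.
  by split=> //; apply/negP.
have [||X [s [TX XA [ha hb hc] hd he]]] := IH (x |: T).
- rewrite -ltnS; apply: leq_trans hn; rewrite ltnS; apply: proper_card.
  apply/properP; split.
    by apply/subsetP => z; rewrite !inE negb_or => /andP[/andP[_ ->]].
  by exists x; rewrite !inE ?xA ?xT // eqxx.
- by rewrite subUset sub1set xA.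
have {TX} [xX TX] : x \in X /\ T \subset X.
  by move: TX; rewrite subUset sub1set => /andP.
exists X, (fun z => if z == x then y else s z); split=> //; split.
- move=> z zX zT ow; case: eqP => [zx|/eqP zx].
    by subst z; case: h => -[] // _ [? /(subsetP TX)].
  by apply: ha => //; rewrite !inE negb_or zx.
- move=> z y' zX zT ow ez y'A; have [zx|zx] := eqVneq z x.
    by subst z; case: h => -[] // _ /(_ _ y'A ez) /(subsetP TX).
  by apply: (hb z) => //; rewrite !inE negb_or zx.
move=> u uA ue hu u0; have [|m] := hc u uA ue _ u0.
  move=> m um; rewrite !inE negb_or => /andP[ux uT] ow.
  by rewrite hu // (negbTE ux).
rewrite !inE => /orP[/eqP ux|]; last by exists m.
exists m.+1; case: h => -[ow].
  by case=> _; rewrite hu ux // eqxx.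
by apply; rewrite // -ux.
Qed.

Lemma subgame_complement_attractor (A X : {set G}) p : subgame A ->
  (forall x y, x \in A -> x \notin X -> own x = p -> e x y -> y \notin X) ->
  (forall x, x \in A -> x \notin X -> own x <> p ->
      exists y, [/\ y \in A, y \notin X & e x y]) ->
  subgame (A :\: X).
Proof.
move=> subA h1 h2 x; rewrite inE => /andP[xX xA].
have [ow|ow] := EM (own x = p).
  have [y yA exy] := subA x xA; exists y => //.
  by rewrite inE yA andbT; apply: h1 exy.
have [y [yA yX exy]] := h2 x xA xX ow.
by exists y; rewrite // inE yX.
Qed.

(** The case where the opponent wins nowhere outside the attractor [X] of the least priority [k]: a
    play sees [k] infinitely often, or from some point on avoids [X] and follows [sB]. *)
Lemma parity_dominion_all (A T X : {set G}) k p sX sB : subgame A -> odd k = p ->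
  (forall x, x \in A -> k <= pr x) -> T = [set x in A | pr x == k] ->
  T \subset X -> X \subset A ->
  (forall x, x \in X -> x \notin T -> own x = p -> e x (sX x) /\ sX x \in X) ->
  (forall x : nat -> G, (forall n, x n \in A) -> (forall n, e (x n) (x n.+1)) ->
      (forall n, x n \in X -> x n \notin T -> own (x n) = p -> x n.+1 = sX (x n)) ->
      x 0 \in X -> exists n, x n \in T) ->
  winning (A :\: X) (A :\: X) p sB ->
  exists s, winning A A p s.
Proof.
move=> subA kp kmin defT TX XA ha hc [w1 w2 w3].
have /choice[sT hT] : forall x, exists y, x \in A -> y \in A /\ e x y.
  move=> x; case: (boolP (x \in A)) => [/subA[y yA exy]|_]; first by exists y.
  by exists x.
exists (fun z => if z \in T then sT z else if z \in X then sX z else sB z).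
split=> //.
  move=> x xA ow; case: ifPn => xT; first by have [] := hT _ xA.
  case: ifPn => xX; first by have [h /(subsetP XA)] := ha _ xX xT ow.
  have [|? ] := w1 x _ ow; first by rewrite inE xX.
  by rewrite inE => /andP[].
move=> x xA xe fx.
have [ho|/infinitely_oftenPn[N hN]] := EM (infinitely_often (fun n => pr (x n) = k)).
  by exists k; split=> //; exists 0 => n _; apply: kmin.
have nX n : N <= n -> x n \notin X.
  move=> Nn; apply/negP => xX.
  have [||||m] := hc (fun m => x (n + m)); rewrite ?addn0 //.
  - by move=> m; rewrite addnS; apply: xe.
  - by move=> m xmX xmT ow; rewrite addnS fx // (negbTE xmT) xmX.
  by rewrite defT inE => /andP[_ /eqP]; apply: hN; lia.
apply/(parity_wins_shift pr p N); apply: w3.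
- by move=> n; rewrite inE xA nX //; lia.
- by move=> n; rewrite addnS; apply: xe.
move=> n ow; have xX : x (N + n) \notin X by apply: nX; lia.
by rewrite addnS fx // (negbTE xX) (negbTE (contra (subsetP TX _) xX)).
Qed.

(** Zielonka's recursion: first the part outside the attractor of the least priority is solved;
    then, if the opponent wins a nonempty set there, the part outside the attractor of that set. *)
Lemma parity_determined (A : {set G}) : subgame A ->
  exists (R : bool -> {set G}) (s : bool -> G -> G),
    (forall p, R p = A :\: R (~~ p)) /\ (forall p, winning A (R p) p (s p)).
Proof.
have [n] := ubnP #|A|; elim: n A => // n IH A hn subA.
have win0 A' p s : winning A' set0 p s.
  by split=> [x|x y|x /(_ 0)]; rewrite inE.
have [->|[z zA]] := set_0Vmem A.
  by exists (fun=> set0), (fun=> id); split=> // p; rewrite set0D.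
have [z0 z0A kmin] := arg_minnP pr zA.
set k := pr z0 in kmin; have [p kp] : exists p, odd k = p by exists (odd k).
pose T := [set x in A | pr x == k].
have TA : T \subset A by apply/subsetP => x; rewrite inE => /andP[].
have [X [sX [TX XA [ha hb hc] hd he]]] := attractor_exists p subA TA.
have subB := subgame_complement_attractor subA hd he.
have [|RB [sB [hRB winB]]] := IH (A :\: X) _ subB.
  rewrite -ltnS; apply: leq_trans hn; rewrite ltnS; apply: proper_card.
  apply/properP; split.
    by apply/subsetP => x; rewrite inE => /andP[].
  exists z0; rewrite ?inE ?z0A // (subsetP TX) // inE eqxx andbT; exact: z0A.
have [W0|[z1 z1W]] := set_0Vmem (RB (~~ p)).
  have [|s hs] := @parity_dominion_all A T X k p sX (sB p) subA kp kmin erefl TX XA ha hc.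
    by have := winB p; rewrite hRB W0 setD0.
  exists (fun b => if b == p then A else set0), (fun=> s); split=> b.
    by case: b; case: (p); rewrite /= ?setD0 ?setDv.
  by case: eqP => // ->.
set q := ~~ p in z1W *; set W := RB q in z1W *.
have WB : W \subset A :\: X by rewrite /W hRB subsetDl.
have WA : W \subset A by apply: subset_trans WB _; apply: subsetDl.
have [Y [sY [WY YA [ya yb yc] yd ye]]] := attractor_exists q subA WA.
have subC := subgame_complement_attractor subA yd ye.
have [|RC [sC [hRC winC]]] := IH (A :\: Y) _ subC.
  rewrite -ltnS; apply: leq_trans hn; rewrite ltnS; apply: proper_card.
  apply/properP; split.
    by apply/subsetP => x; rewrite inE => /andP[].
  by exists z1; rewrite ?inE ?(subsetP WY) // (subsetP WA).
have RCC b x : x \in RC b -> x \in A /\ x \notin Y.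
  by rewrite hRC !inE => /andP[_ /andP[]].
have [b1 b2 b3] := winB q; rewrite -/W in b1 b2 b3.
(* [W] traps [p] in all of [A], not only outside [X]: from outside its own attractor, player [p]
   cannot enter it. *)
have Wtrap x y : x \in W -> own x <> q -> e x y -> y \in A -> y \in W.
  move=> xW ow exy yA; apply: (b2 x) => //; rewrite inE yA andbT.
  move/(subsetP WB): xW; rewrite inE => /andP[xX xA].
  by apply: (hd x) => //; move: ow; rewrite /q; case: (own x) (p) => -[].
pose s' z := if z \in W then sB q z else if z \in Y then sY z else sC q z.
exists (fun b => if b == q then Y :|: RC q else RC p).
exists (fun b => if b == q then s' else sC p); split.
  have qE : q = ~~ p by []; have h : RC p = A :\: (Y :|: RC q).
    by rewrite hRC -qE setDDl.
  have h' : Y :|: RC q = A :\: RC p.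
    rewrite h setDDr setDv set0U; apply/esym/setIidPr.
    by rewrite subUset YA; apply/subsetP => x /RCC[].
  have npq : (p == q) = false by rewrite /q; case: (p).
  move=> b; have [->|->] : b = q \/ b = p by rewrite /q; case: b (p) => -[]; auto.
    by rewrite eqxx /q negbK -/q npq.
  by rewrite -/q eqxx npq.
move=> b; case: eqP => [->|bq]; last first.
  have -> : b = p by move: bq; rewrite /q; case: b (p) => -[].
  have [c1 c2 c3] := winC p; split=> // x y xR ow exy yA.
  have [xA xY] := RCC _ _ xR.
  apply: (c2 x) => //; rewrite inE yA andbT; apply: (yd x) => //.
  by move: ow; rewrite /q; case: (own x) (p) => -[].
have [c1 c2 c3] := winC q; split.
- move=> x; rewrite /s' inE => xR ow; case: ifPn => xW.
    by have [? h] := b1 _ xW ow; rewrite inE (subsetP WY).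
  case: ifPn => xY; first by have [? h] := ya _ xY xW ow; rewrite inE h.
  by rewrite (negbTE xY) in xR; have [? h] := c1 _ xR ow; rewrite inE h orbT.
- move=> x y; rewrite !inE => xR ow exy yA.
  have [xW|xW] := boolP (x \in W).
    by rewrite (subsetP WY) // (Wtrap x).
  have [yY|yY] //= := boolP (y \in Y).
  have [xY|xY] := boolP (x \in Y); first by rewrite (yb x) in yY.
  by rewrite (negbTE xY) in xR; apply: (c2 x); rewrite // inE yY.
move=> x xR xe fx.
have xA m : x m \in A.
  by have := xR m; rewrite inE => /orP[/(subsetP YA)|/RCC[]].
(* A play entering [Y] reaches [W] and stays there, where [sB q] wins; any other play stays in
   [RC q]. Finite prefixes do not affect the winner. *)
have [[m xY]|nY] := EM (exists m, x m \in Y); last first.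
  have nY' m : x m \notin Y by apply/negP => h; apply: nY; exists m.
  have xC m : x m \in RC q by have := xR m; rewrite inE (negbTE (nY' m)).
  apply: c3 => // m ow; rewrite fx // /s' (negbTE (nY' m)).
  by rewrite (negbTE (contra (subsetP WY _) (nY' m))).
have [||||l xW] := yc (fun l => x (m + l)); rewrite ?addn0 //.
- by move=> l; rewrite addnS; apply: xe.
- by move=> l h1 h2 ow; rewrite addnS fx // /s' (negbTE h2) h1.
have stay i : x (m + l + i) \in W.
  elim: i => [|i xi]; first by rewrite addn0.
  have [ow|ow] := EM (own (x (m + l + i)) = q).
    by rewrite addnS fx // /s' xi; have [] := b1 _ xi ow.
  by apply: Wtrap xi ow _ (xA _); rewrite addnS; apply: xe.
apply/(parity_wins_shift pr q (m + l)); apply: b3 => //.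
  by move=> i; rewrite addnS; apply: xe.
by move=> i ow; rewrite addnS fx // /s' stay.
Qed.

End Parity.

(** * Payoffs and priorities *)

Section Payoff.
Variables (V : Type) (S : finType) (phi : seq V -> S).
Variable R : word V -> word V -> Prop.
Hypothesis satl : forall y, saturates phi (fun x => R x y).
Hypothesis satr : forall x, saturates phi (R x).

Definition payoff (y : word V) : nat :=
  #|[set c : S * S | `[< exists x, factors phi x c /\ R x y >]]|.

Lemma payoff_le_card y : payoff y <= #|{: S * S}|.
Proof. exact: max_card. Qed.

Lemma payoff_saturated t : saturates phi (fun y => t <= payoff y).
Proof.
move=> c y y' fy fy'; rewrite (_ : payoff y = payoff y') //.
apply: eq_card => d; rewrite !inE; apply/asboolP/asboolP => -[x [fx xy]];
  exists x; split=> //; first exact: (satr fy fy').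
exact: (satr fy' fy).
Qed.

(** Transitivity makes the counted sets grow. The pair of [z] is counted for [z] by reflexivity but
    not for [y], since left saturation would turn such a representative into [R z y]. *)
Lemma payoff_strict y z c : preorder_rel R -> factors phi z c ->
  strict R y z -> payoff y < payoff z.
Proof.
move=> [Rrefl Rtrans] fz [yz nzy]; apply/proper_card/properP; split.
  apply/subsetP => d; rewrite !inE => /asboolP[x [fx xy]]; apply/asboolP.
  by exists x; split=> //; apply: Rtrans yz.
exists c; rewrite inE; first by apply/asboolP; exists z.
apply/negP => /asboolP[x [fx xy]]; apply: nzy.
exact: (satl fx fz).
Qed.

End Payoff.

Lemma recognizable_saturated V S (phi : seq V -> S) R (s : seq (buchi V * buchi V)) :
  (forall x y, R x y <->
    exists2 p, List.In p s & buchi_accepts p.1 x /\ buchi_accepts p.2 y) ->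
  (forall p, List.In p s -> saturates phi (buchi_accepts p.1) /\
                            saturates phi (buchi_accepts p.2)) ->
  (forall y, saturates phi (fun x => R x y)) /\ (forall x, saturates phi (R x)).
Proof.
move=> RE sat; split=> z c w w' fw fw' /RE[p ps [h1 h2]]; apply/RE; exists p => //;
  have [s1 s2] := sat p ps; split=> //.
- exact: (s1 _ _ _ fw fw').
- exact: (s2 _ _ _ fw fw').
Qed.

Section Priority.
Variables (V : Type) (S : finType) (phi : seq V -> S) (mul : S -> S -> S).
Hypothesis phiM : multiplicative phi mul.
Variable N : nat.
Hypothesis cardS : #|S| <= N.
Variable X : word V -> Prop.
Hypothesis satX : saturates phi X.

Definition priority (x : V * N.-bseq S) : nat :=
  (level phi mul x.2 x.1).*2 +
  ~~ `[< exists y, factors phi y (label phi mul x.2 x.1) /\ X y >].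

(** Labels recurring at the limit level [k] are pairs of [w] itself. So for [w] in [X] the priority
    [k.*2] recurs; otherwise labels with a representative in [X] die out at level [k], and [k.*2.+1]
    is the least recurring priority. *)
Lemma priority_wins w :
  (X w -> parity_wins priority false (fun n => (w n, det_run phi mul N w n))) /\
  (~ X w -> parity_wins priority true (fun n => (w n, det_run phi mul N w n))).
Proof.
have [k [ho hev hlab]] := det_run_factors phiM cardS w.
have [c hc] := infinitely_often_pigeonhole
  (fun n => label phi mul (det_run phi mul N w n) (w n)) ho.
have fw := hlab _ hc; split=> Xw.
  exists k.*2; split; first by rewrite odd_double.
    apply: infinitely_often_sub hc => n [hk hl]; rewrite /priority /= hk hl.
    by rewrite asboolT ?addn0 //; exists w.
  by case: hev => M hM; exists M => n /hM; rewrite /priority /=; lia.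
exists k.*2.+1; split; first by rewrite /= odd_double.
  apply: infinitely_often_sub hc => n [hk hl]; rewrite /priority /= hk hl.
  by rewrite asboolF ?addn1 // => -[y [fy Xy]]; apply: Xw; apply: satX fy fw Xy.
pose good n := exists y, factors phi y
  (label phi mul (det_run phi mul N w n) (w n)) /\ X y.
have : ~ infinitely_often (fun n =>
    level phi mul (det_run phi mul N w n) (w n) = k /\ good n).
  move=> /infinitely_often_pigeonhole - /(_ _
    (fun n => label phi mul (det_run phi mul N w n) (w n)))[d hd].
  have fd : factors phi w d.
    by apply: hlab; apply: infinitely_often_sub hd => n [[]].
  have [n _ [[_ [y [fy Xy]]] dE]] := hd 0.
  by apply: Xw; apply: satX Xy; rewrite ?dE in fy; [exact: fy|].
move/infinitely_oftenPn/(eventually_and hev) => [M hM]; exists M => n /hM[h1 h2].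
rewrite /priority /=; case: asboolP => /= hg; last lia.
by have : level phi mul (det_run phi mul N w n) (w n) <> k; [move=> ek; apply: h2|lia].
Qed.

End Priority.

(** * Strategies optimal for all thresholds *)

Section Uniform.
Variables (G : finType) (e : rel G) (own : G -> bool) (p : bool).
Variables (M : nat) (pr : nat -> G -> nat) (R : nat -> {set G}) (s : nat -> G -> G).
Hypothesis total : forall x, exists y, e x y.
Hypothesis win : forall t, winning e own (pr t) setT (R t) p (s t).

(* Following the winning strategy of the best threshold won at the current
   vertex, that threshold never decreases, hence stabilizes. *)
Lemma uniform_strategy : exists u : G -> G,
  (forall x, own x = p -> e x (u x)) /\
  forall x, (forall n, e (x n) (x n.+1)) -> follows own p u x ->
  forall t, t <= M -> x 0 \in R t ->
  exists t', t <= t' <= M /\ parity_wins (pr t') p x.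
Proof.
have /choice[succ hsucc] := total.
pose rank x := \max_(t < M.+1 | x \in R t) t.
have rankP x t : t <= M -> x \in R t -> t <= rank x <= M /\ x \in R (rank x).
  move=> tM xt; have t0 : x \in R (Ordinal (tM : t < M.+1)) by [].
  have [|t' xt' et'] := @eq_bigmax_cond _
    [pred t : 'I_M.+1 | x \in R t] (@nat_of_ord M.+1).
    by apply/card_gt0P; exists (Ordinal (tM : t < M.+1)).
  have et : rank x = t' := et'; have := ltn_ord t'; rewrite ltnS => t'M.
  split; last by rewrite et.
  rewrite {2}et t'M andbT -[t]/(nat_of_ord (Ordinal (tM : t < M.+1))).
  exact: (leq_bigmax_cond (P := fun t : 'I_M.+1 => x \in R t)).
(* The empty maximum is 0, so a vertex winning no threshold has rank 0 and moves to an arbitrary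
   successor. *)
pose u x := if x \in R (rank x) then s (rank x) x else succ x.
exists u; split.
  move=> x ow; rewrite /u; case: ifP => // xR.
  by have [h _ _] := win (rank x); have [] := h x xR ow.
move=> x xe fx t tM x0.
have rx n : t <= rank (x n) <= M /\ x n \in R (rank (x n)).
  elim: n => [|n [/andP[tr rM] xR]]; first exact: rankP.
  suff /(rankP _ _ rM)[/andP[h1 ->] ->] : x n.+1 \in R (rank (x n)).
    by rewrite (leq_trans tr).
  have [h1 h2 _] := win (rank (x n)); have [ow|ow] := EM (own (x n) = p).
    by rewrite fx // /u xR; have [] := h1 _ xR ow.
  exact: (h2 (x n)).
have mono m n : m <= n -> rank (x m) <= rank (x n).
  elim: n => [|n IH]; first by rewrite leqn0 => /eqP->.
  rewrite leq_eqVlt => /orP[/eqP->//|/IH mn]; apply: leq_trans mn _.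
  have [/andP[_ rM] xR] := rx n.
  suff /(rankP _ _ rM)[/andP[h1 _] _] : x n.+1 \in R (rank (x n)) by [].
  have [h1 h2 _] := win (rank (x n)); have [ow|ow] := EM (own (x n) = p).
    by rewrite fx // /u xR; have [] := h1 _ xR ow.
  exact: (h2 (x n)).
have [|k [ho [N hN]]] := @bounded_liminf (fun n => rank (x n)) M.
  by exists 0 => n _; have [/andP[]] := rx n.
have rk n : N <= n -> rank (x n) = k.
  move=> Nn; apply/eqP; rewrite eqn_leq hN // andbT.
  by have [m nm <-] := ho n; apply: mono.
exists k; split; first by rewrite -(rk N) //; have [] := rx N.
apply/(parity_wins_shift _ p N); have [_ _ h3] := win k; apply: h3.
- by move=> n; rewrite -(rk (N + n)) ?leq_addr //; have [] := rx (N + n).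
- by move=> n; rewrite addnS; apply: xe.
move=> n ow; rewrite addnS fx // /u rk ?leq_addr //.
by have [_ ] := rx (N + n); rewrite rk ?leq_addr // => ->.
Qed.

End Uniform.

(** * Optimal and punishing strategies in the product arena *)

Section Values.
Variables (V P : finType) (E : rel V) (owner : V -> P).
Hypothesis hE : forall v, exists v', E v v'.
Variables (S : finType) (phi : seq V -> S) (mul : S -> S -> S).
Hypothesis phiM : multiplicative phi mul.
Variable N : nat.
Hypothesis cardS : #|S| <= N.
Local Notation D := (N.-bseq S).
Local Notation run := (det_run phi mul N).

(** [W t] is the region where player [i] secures payoff [t]; [opt] and [pun] serve all thresholds at
    once. The last two clauses start at an arbitrary time [m], so that they apply from a deviation
    on. *)
Lemma value_strategies (i : P) (f : word V -> nat) M :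
  (forall t, saturates phi (fun w => t <= f w)) ->
  exists z : (nat -> V * D -> bool) * (V * D -> V) * (V * D -> V),
    let: (W, opt, pun) := z in
    [/\ forall v d, owner v = i -> E v (opt (v, d)),
        forall v d, owner v <> i -> E v (pun (v, d)),
        forall w m t, (forall n, E (w n) (w n.+1)) -> t <= M ->
          (forall n, m <= n -> owner (w n) = i -> w n.+1 = opt (w n, run w n)) ->
          W t (w m, run w m) -> t <= f w
      & forall w m t, (forall n, E (w n) (w n.+1)) -> t <= M ->
          (forall n, m <= n -> owner (w n) <> i -> w n.+1 = pun (w n, run w n)) ->
          ~~ W t (w m, run w m) -> f w < t].
Proof.
move=> satf.
pose e (x y : V * D) := E x.1 y.1 && (y.2 == det_step phi mul x.2 x.1).
pose own (x : V * D) := owner x.1 != i.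
pose pr t := priority phi mul (fun w => t <= f w) : V * D -> nat.
have total x : exists y, e x y.
  by have [v h] := hE x.1; exists (v, det_step phi mul x.2 x.1); rewrite /e h /=.
have /choice[RS hRS] : forall t, exists RS : (bool -> {set V * D}) *
    (bool -> V * D -> V * D), (forall b, RS.1 b = setT :\: RS.1 (~~ b)) /\
    forall b, winning e own (pr t) setT (RS.1 b) b (RS.2 b).
  move=> t; have [|R [s h]] := @parity_determined _ e own (pr t) setT.
    by move=> x _; have [y] := total x; exists y.
  by exists (R, s).
have [u [u1 u2]] := @uniform_strategy _ e own false M pr (fun t => (RS t).1 false)
  (fun t => (RS t).2 false) total (fun t => (hRS t).2 false).
(* The coalition prefers small payoffs, so thresholds are reversed: a larger index [t] means keeping
   the payoff below a smaller bound [M - t]. *)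
have [u' [u'1 u'2]] := @uniform_strategy _ e own true M (fun t => pr (M - t))
  (fun t => (RS (M - t)).1 true)
  (fun t => (RS (M - t)).2 true) total (fun t => (hRS (M - t)).2 true).
have ownF v d : own (v, d) = false <-> owner v = i.
  by rewrite /own /=; split=> [/negbFE/eqP|->]; rewrite ?eqxx.
have ownT v d : own (v, d) = true <-> owner v <> i.
  by rewrite /own /=; split=> /eqP.
have edge w n : E (w n) (w n.+1) -> e (w n, run w n) (w n.+1, run w n.+1).
  by rewrite /e /= => ->; rewrite eqxx.
exists (fun t x => x \in (RS t).1 false, fun x => (u x).1, fun x => (u' x).1); split.
- by move=> v d /(ownF v d)/u1/andP[].
- by move=> v d /(ownT v d)/u'1/andP[].
- move=> w m t wE tM hw hW.
  have [|||t' [/andP[tt' _] hwin]] := u2 (fun n => (w (m + n), run w (m + n))) _ _ t tM.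
  + by move=> n; rewrite addnS; apply: edge.
  + move=> n ow; have /andP[_ /eqP h2] := u1 _ ow; rewrite addnS.
    rewrite hw ?leq_addr //; last by move/ownF: ow.
    by move: h2 => /=; case: (u _) => ? ? /= ->.
  + by rewrite addn0.
  have {}hwin := (parity_wins_shift _ _ m (fun n => (w n, run w n))).1 hwin.
  apply: leq_trans tt' _; apply: contrapT => /(priority_wins phiM cardS (satf t') w).2.
  by move=> /parity_wins_exclusive; apply.
move=> w m t wE tM hw hW.
have [|||t' [/andP[tt' t'M] hwin]] :=
  u'2 (fun n => (w (m + n), run w (m + n))) _ _ (M - t) (leq_subr _ _).
- by move=> n; rewrite addnS; apply: edge.
- move=> n ow; have /andP[_ /eqP h2] := u'1 _ ow; rewrite addnS.
  rewrite hw ?leq_addr //; last by move/ownT: ow.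
  by move: h2 => /=; case: (u' _) => ? ? /= ->.
- by rewrite subKn // (hRS t).1 inE addn0 /= hW inE.
have {}hwin := (parity_wins_shift _ _ m (fun n => (w n, run w n))).1 hwin.
apply: (@leq_trans (M - t')); last lia.
rewrite ltnNge; apply/negP => /(priority_wins phiM cardS (satf (M - t')) w).1.
by move/(parity_wins_exclusive hwin).
Qed.

End Values.

(** * The equilibrium *)

Lemma outcomeS V P (owner : V -> P) sigma v0 n :
  outcome owner sigma v0 n.+1 =
  sigma (owner (outcome owner sigma v0 n))
        (segment (outcome owner sigma v0) 0 n) (outcome owner sigma v0 n).
Proof.
suff h m : (play_prefix owner sigma v0 m).1 = segment (outcome owner sigma v0) 0 m.
  by rewrite {1}/outcome /= -h /outcome; case: play_prefix.
elim: m => //= m IH; rewrite segmentS // -IH /outcome.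
by case: play_prefix.
Qed.

Section Equilibrium.
Variables (V P D : finType) (E : rel V) (owner : V -> P) (v0 : V).
Variables (d0 : D) (step : D -> V -> D).
Variables (opt pun : P -> V * D -> V).
Hypothesis optE : forall i v d, owner v = i -> E v (opt i (v, d)).
Hypothesis punE : forall i v d, owner v <> i -> E v (pun i (v, d)).

(* Memory: automaton state, detected deviator, vertex expected next, owner of
   the previous vertex. *)
Definition memory : finType := (D * option P * V * P)%type.

Definition memory0 : memory := (d0, None, v0, owner v0).

(** The memory covers the vertices strictly before [v], so an unexpected [v] is blamed on the owner
    of the previous vertex; the first blame is kept forever. *)
Definition deviator (m : memory) (v : V) : option P :=
  let: (_, o, expected, previous) := m in
  if o is Some i then Some i else if v == expected then None else Some previous.

Definition move_of (m : memory) (v : V) : V :=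
  let: (d, _, _, _) := m in
  if deviator m v is Some i then
    if owner v == i then opt i (v, d) else pun i (v, d)
  else opt (owner v) (v, d).

Definition update (m : memory) (v : V) : memory :=
  let: (d, _, _, _) := m in (step d v, deviator m v, move_of m v, owner v).

Definition punishing_profile (i : P) : strategy V :=
  fun h v => move_of (foldl update memory0 h) v.

Definition memory_at (w : word V) n := foldl update memory0 (segment w 0 n).

Lemma move_of_edge m v : E v (move_of m v).
Proof.
case: m => [[[d o] ex] pv]; rewrite /move_of; case: deviator => [i|].
  by case: eqP => h; [apply: optE|apply: punE].
exact: optE.
Qed.

Lemma punishing_profile_finite_memory i :
  finite_memory owner i (punishing_profile i).
Proof. by exists memory, memory0, update, move_of. Qed.

Lemma memory_atS w n : memory_at w n.+1 = update (memory_at w n) (w n).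
Proof. by rewrite /memory_at segmentS // foldl_rcons. Qed.

Lemma memory_at_state w run : run 0 = d0 ->
  (forall n, run n.+1 = step (run n) (w n)) ->
  forall n, (memory_at w n).1.1.1 = run n.
Proof.
move=> r0 rS; elim=> // n IH; rewrite memory_atS rS -IH.
by case: memory_at => [[[d o] ex] pv].
Qed.

Lemma deviator_update m v v' : deviator (update m v) v' =
  if deviator m v is Some i then Some i
  else if v' == move_of m v then None else Some (owner v).
Proof. by case: m => [[[d o] ex] pv]. Qed.

Lemma eq_memory_at w w' n : (forall m, m < n -> w m = w' m) ->
  memory_at w n = memory_at w' n.
Proof.
move=> ww'; rewrite /memory_at; congr foldl; apply/eq_in_map => m.
by rewrite mem_iota subn0 => /ww'.
Qed.

Lemma deviator_main n : let rho := outcome owner punishing_profile v0 in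
  deviator (memory_at rho n) (rho n) = None.
Proof.
move=> rho; elim: n => [|n IH]; first by rewrite /= eqxx.
rewrite memory_atS /rho outcomeS -/rho /punishing_profile -/(memory_at rho n).
by case: memory_at IH => [[[d o] ex] pv] /= ->; rewrite eqxx.
Qed.

Lemma main_follows n : let rho := outcome owner punishing_profile v0 in
  rho n.+1 = opt (owner (rho n)) (rho n, (memory_at rho n).1.1.1).
Proof.
move=> rho; have := deviator_main n; rewrite -/rho {2}/rho outcomeS -/rho.
rewrite /punishing_profile -/(memory_at rho n).
by case: memory_at => [[[d o] ex] pv]; rewrite /move_of => ->.
Qed.

Lemma deviation_follows i tau n :
  let rho := outcome owner (deviate punishing_profile i tau) v0 in
  owner (rho n) <> i -> rho n.+1 = move_of (memory_at rho n) (rho n).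
Proof. by move=> rho /eqP/negbTE ow; rewrite /rho outcomeS -/rho /deviate ow. Qed.

Lemma no_deviator_prefix i tau n :
  let rho := outcome owner punishing_profile v0 in
  let rho' := outcome owner (deviate punishing_profile i tau) v0 in
  (forall m, m <= n -> deviator (memory_at rho' m) (rho' m) = None) ->
  forall m, m <= n -> rho' m = rho m.
Proof.
move=> rho rho'; elim: n => [|n IH] hdev m.
  by rewrite leqn0 => /eqP->.
have {}IH : forall m, m <= n -> rho' m = rho m.
  by apply: IH => l ln; apply: hdev; apply: leqW.
rewrite leq_eqVlt => /orP[/eqP->|]; last exact: IH.
have rhoS : rho n.+1 = move_of (memory_at rho n) (rho n) by rewrite /rho outcomeS.
rewrite rhoS; have := hdev _ (leqnn _).
rewrite memory_atS (@eq_memory_at rho' rho); last first.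
  by move=> l ln; apply: IH; apply: ltnW.
rewrite IH //; case: memory_at => [[[d o] ex] pv] /=.
by case: (if o is Some _ then _ else _) => //; case: eqP.
Qed.

(** Detection comes one step late: if the first unexpected vertex is at [m.+1], the choice was made
    at [m], necessarily by [i], since all others follow the machine. *)
Lemma first_deviation i tau :
  let rho := outcome owner punishing_profile v0 in
  let rho' := outcome owner (deviate punishing_profile i tau) v0 in
  rho' = rho \/ exists m, [/\ forall l, l <= m -> rho' l = rho l,
    owner (rho' m) = i
    & forall n, m <= n -> owner (rho' n) <> i ->
      rho' n.+1 = pun i (rho' n, (memory_at rho' n).1.1.1)].
Proof.
move=> rho rho'; pose bad n := deviator (memory_at rho' n) (rho' n) != None.
have [[n0 hn0]|none] := EM (exists n, bad n); last first.
  left; apply: funext => n; apply: (@no_deviator_prefix i tau n) (leqnn n) => m _.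
  by apply: contrapT => h; apply: none; exists m; apply/eqP.
right; have [[|m] badm minm] := ex_minnP (ex_intro _ n0 hn0).
  by rewrite /bad /= eqxx in badm.
have good l : l <= m -> deviator (memory_at rho' l) (rho' l) = None.
  by move=> lm; apply/eqP/negPn/negP => /minm; rewrite ltnNge lm.
have dm : owner (rho' m) = i /\
    deviator (memory_at rho' m.+1) (rho' m.+1) = Some (owner (rho' m)).
  move: badm; rewrite /bad memory_atS deviator_update (good m (leqnn m)).
  case: ifPn => // /eqP ne _; split=> //; apply: contrapT => ow.
  by apply: ne; apply: deviation_follows.
case: dm => owm dm; exists m; split=> //; first exact: no_deviator_prefix.
have dn n : m < n -> deviator (memory_at rho' n) (rho' n) = Some i.
  elim: n => // n IH; rewrite ltnS leq_eqVlt => /orP[/eqP<-|/IH].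
    by rewrite dm owm.
  by rewrite memory_atS deviator_update => ->.
move=> n mn ow; have mn' : m < n.
  by rewrite ltn_neqAle mn andbT; apply/eqP => e; rewrite -e in ow.
have -> : rho' n.+1 = move_of (memory_at rho' n) (rho' n) by apply: deviation_follows.
move/dn: mn'.
case: memory_at => [[[d o] ex] pv]; rewrite /move_of => ->.
by case: eqP.
Qed.

Lemma outcome_edge sigma : (forall i, is_strategy E owner i (sigma i)) ->
  forall n, E (outcome owner sigma v0 n) (outcome owner sigma v0 n.+1).
Proof. by move=> hs n; rewrite outcomeS; apply: hs. Qed.

End Equilibrium.

Lemma In_mem (T : eqType) (x : T) s : x \in s -> List.In x s.
Proof.
by elim: s => //= y s IH; rewrite inE => /orP[/eqP->|/IH]; [left|right].
Qed.

Theorem theorem11 (V P : finType) (E : rel V) (owner : V -> P)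
  (hE : forall v, exists v', E v v')
  (pref : P -> word V -> word V -> Prop)
  (hpre : forall i, preorder_rel (pref i))
  (hrec : forall i, omega_recognizable (pref i)) :
  forall v0 : V, exists sigma : P -> strategy V,
    nash_eq E owner pref v0 sigma /\ (forall i, finite_memory owner i (sigma i)).
Proof.
move=> v0; have /choice[s hs] := hrec.
(* One recognizer serves all players: the list holds both components of every pair of automata. *)
have [S [phi [mul [phiM hphi]]]] := common_recognizer
  (List.flat_map (fun i => List.flat_map (fun p => [:: p.1; p.2]) (s i)) (enum P)).
have {hphi} sat i : (forall y, saturates phi (fun x => pref i x y)) /\
    (forall x, saturates phi (pref i x)).
  apply: (recognizable_saturated (hs i)) => p ps.
  by split; apply: hphi; apply/List.in_flat_map; exists i;
    (split; first by apply: In_mem; rewrite mem_enum);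
    apply/List.in_flat_map; exists p; split=> //=; [left|right; left].
pose N := #|S|; pose M := #|{: S * S}|; pose f i := payoff phi (pref i).
(* In place of Ramsey's theorem, a label recurring at the limit level provides a factorization of
   each word. *)
have /choice[fac hfac] : forall w, exists c, factors phi w c.
  move=> w; have [k [ho _ h]] := det_run_factors phiM (leqnn _) w.
  have [c hc] := infinitely_often_pigeonhole
    (fun n => label phi mul (det_run phi mul #|S| w n) (w n)) ho.
  by exists c; apply: h.
have /choice[z hz] := fun i => value_strategies owner hE phiM (leqnn N) i M
  (payoff_saturated (sat i).2).
pose W i := (z i).1.1; pose opt i := (z i).1.2; pose pun i := (z i).2.
have {}hz i : [/\ forall v d, owner v = i -> E v (opt i (v, d)),
        forall v d, owner v <> i -> E v (pun i (v, d)),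
        forall w m t, (forall n, E (w n) (w n.+1)) -> t <= M ->
          (forall n, m <= n -> owner (w n) = i ->
             w n.+1 = opt i (w n, det_run phi mul N w n)) ->
          W i t (w m, det_run phi mul N w m) -> t <= f i w
      & forall w m t, (forall n, E (w n) (w n.+1)) -> t <= M ->
          (forall n, m <= n -> owner (w n) <> i ->
             w n.+1 = pun i (w n, det_run phi mul N w n)) ->
          ~~ W i t (w m, det_run phi mul N w m) -> f i w < t].
  by have := hz i; rewrite /W /opt /pun; case: (z i) => [[]].
have optE i v d : owner v = i -> E v (opt i (v, d)) by have [h _ _ _] := hz i; apply: h.
have punE i v d : owner v <> i -> E v (pun i (v, d)) by have [_ h _ _] := hz i; apply: h.
pose D : finType := N.-bseq S; pose d0 : D := insub_bseq N [::].
pose step : D -> V -> D := @det_step V S phi mul N.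
pose sigma := punishing_profile owner v0 d0 step opt pun.
have state w n := @memory_at_state V P _ owner v0 d0 step
  opt pun w (det_run phi mul N w) erefl (fun n => erefl) n.
have hsig i : is_strategy E owner i (sigma i) by move=> h v _; apply: move_of_edge.
exists sigma; split; last by move=> i; apply: punishing_profile_finite_memory.
split=> // i tau htau hstrict.
have := payoff_strict (sat i).1 (hpre i) (hfac _) hstrict; rewrite -/(f i).
have [eq|[m [pre owm hpun]]] := first_deviation owner v0 d0
  step opt pun i tau.
  by rewrite -/sigma in eq; rewrite eq ltnn.
rewrite -/sigma in pre owm hpun.
set rho := outcome owner sigma v0; set rho' := outcome owner _ v0.
rewrite -/rho -/rho' in pre owm hpun.
have edge' n : E (rho' n) (rho' n.+1).
  by apply: outcome_edge => j; rewrite /deviate; case: eqP => [->|_].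
have edge n : E (rho n) (rho n.+1) by apply: outcome_edge.
have [_ _ hopt hlow] := hz i.
have tM : f i rho' <= M by apply: payoff_le_card.
apply/negP; rewrite -leqNgt.
(* The automaton state at time [m] depends only on earlier vertices, so both plays are at the same
   position of the product arena. *)
have eqm : (rho' m, det_run phi mul N rho' m) = (rho m, det_run phi mul N rho m).
  rewrite -!state pre // (@eq_memory_at _ _ _ _ _ _ _ _ _ rho' rho) // => l lm.
  by apply: pre; apply: ltnW.
(* The threshold is the payoff of the deviation. If [i] secures it at this position, the main play,
   which follows [opt i], already yields it; otherwise the punishment keeps that payoff strictly
   below itself. *)
have [hW|hW] := boolP (W i (f i rho') (rho m, det_run phi mul N rho m)).
  apply: hopt hW => // n _ ow; rewrite -state -[in opt i]ow.
  exact: main_follows.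
have := hlow rho' m (f i rho') edge' tM; rewrite eqm hW ltnn.
move=> /(_ _ isT) h; suff : false by [].
by apply: h => n mn ow; rewrite -state; apply: hpun.
Qed.
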